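(* Let $A\in\mathbb{R}^{n\times n}$ and $B\in\mathbb{R}^{n\times m}$. Let $\lambda_1,\ldots,\lambda_h\in\mathbb{C}$ be distinct, and disjoint from the uncontrollable eigenvalues of $(A,B)$. For each $i\in\{1,\ldots,h\}$ let $\begin{bmatrix} V_i\\ W_i\end{bmatrix}$ be a basis matrix for $\ker\,[\,A-\lambda_i I\;\; B\,]$, where $V_i$ has $n$ rows and $W_i$ has $m$ rows. Then $$\operatorname{rank}\,[\,V_1\;\;V_2\;\;\cdots\;\;V_h\,]=\operatorname{rank}\,[\,B\;\;AB\;\;\cdots\;\;A^{h-1}B\,].$$
   Context: An uncontrollable eigenvalue of $(A,B)$ is a number $\lambda\in\mathbb{C}$ such that $\operatorname{rank}[\,A-\lambda I\;\;B\,]<n$. A basis matrix for a subspace is a matrix whose columns form a basis of that subspace. Kernels and ranks are taken over $\mathbb{C}$. *)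

(* Defs.v *)
From HB Require Import structures.
From mathcomp Require Import all_boot all_order all_algebra.
From mathcomp Require Import complex reals.

Set Implicit Arguments.
Unset Strict Implicit.
Unset Printing Implicit Defensive.

Import GRing.Theory Num.Theory.
Local Open Scope ring_scope.

(* The kernel { x | M x = 0 } on column vectors, unlike kermx, which is the
   kernel of M acting on row vectors. *)
Definition colker (F : fieldType) (q p : nat) (M : 'M[F]_(q, p)) :
  {vspace 'cV[F]_p} := lker (linfun (mulmx M : 'cV[F]_p -> 'cV[F]_q)).

Definition basis_matrix (F : fieldType) (p k : nat) (U : {vspace 'cV[F]_p})
  (X : 'M[F]_(p, k)) : bool := basis_of U [tuple col j X | j < k].

Definition complexify (R : realType) (p q : nat) (M : 'M[R]_(p, q)) :
  'M[R[i]]_(p, q) := map_mx (real_complex R) M.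

Definition pencil (R : realType) (n m : nat) (A : 'M[R]_n) (B : 'M[R]_(n, m))
  (z : R[i]) : 'M[R[i]]_(n, n + m) :=
  row_mx (complexify A - z%:M) (complexify B).

Definition uncontrollable_eigenvalue (R : realType) (n m : nat) (A : 'M[R]_n)
  (B : 'M[R]_(n, m)) (z : R[i]) : bool := (\rank (pencil A B z) < n)%N.

(* Main.v *)
Require Import Defs.
From HB Require Import structures.
From mathcomp Require Import all_boot all_order all_algebra.
From mathcomp Require Import complex reals.

Set Implicit Arguments.
Unset Strict Implicit.
Unset Printing Implicit Defensive.

Import GRing.Theory Num.Theory.
Local Open Scope ring_scope.

(** The proof compares left null spaces. Write [p(x) = prod_i (x - lambda_i)],
[p_i = p / (x - lambda_i)], and [K] for the matrix [B, AB, ..., A^(h-1) B].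
A row vector [z] kills [K] exactly when [z q(A) B = 0] for every polynomial [q]
of degree [< h]. On the other side, the columns of [V_i; W_i] span the kernel of
the pencil [A - lambda_i, B], so [y V_i = 0] exactly when [(y, 0)] is a row
combination of the pencil, that is, when some [z_i] satisfies
[z_i (A - lambda_i) = y] and [z_i B = 0] (lemma [mulmx_basis_colker_eq0]).

The map [z |-> z p(A)] is then a bijection from the left null space of [K] to
that of [V_1, ..., V_h], so both matrices have the same rank:

- it lands in the second space: take [z_i = z p_i(A)], as [deg p_i < h];
- it is onto: if the vector [y] has a witness [z_i] for each [lambda_i], the
  witnesses are glued by a Bezout identity, in the manner of the Chinese
  remainder theorem, to some [z] with [z p(A) = y] that kills [K] (lemma
  [left_null_glue]); the [lambda_i] have to be distinct here;
- it is injective: the factors [A - lambda_i] can be cancelled one at a time,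
  because full row rank of [A - lambda_i, B] says that [w (A - lambda_i) = 0]
  and [w B = 0] force [w = 0] (lemma [left_null_inj]).

No [A - lambda_i] is inverted, so the [lambda_i] may be eigenvalues of [A].
The argument works over any field; matrices with [r] rows stand for [r] row
vectors treated at once. *)

(** * Blocks and kernels *)

Lemma map_mxrow (S T : Type) (f : S -> T) (p h : nat) (q : 'I_h -> nat)
    (C : forall i : 'I_h, 'M[S]_(p, q i)) :
  map_mx f (\mxrow_(i < h) C i) = \mxrow_(i < h) map_mx f (C i).
Proof. by apply/matrixP => x y; rewrite !mxE. Qed.

Lemma mxrow_eq0 (U : nmodType) (p h : nat) (q : 'I_h -> nat)
    (C : forall i : 'I_h, 'M[U]_(p, q i)) :
  \mxrow_(i < h) C i = 0 <-> forall i, C i = 0.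
Proof.
split=> [C0 i | C0].
  have /(congr1 (fun M => submxrow M i)) := C0.
  by rewrite mxrowK => ->; apply/matrixP => x y; rewrite !mxE.
by rewrite -[RHS](@mxrow0 U); apply: eq_mxrow.
Qed.

(** If [M X = 0] then every row combination of [M] kills [X]; conversely the
columns of [cokermx M], which detect membership in the row space of [M], lie in
the kernel of [M] and hence are combinations of the columns of [X]. *)
Lemma mulmx_basis_colker_eq0 (F : fieldType) (q p c r : nat) (M : 'M[F]_(q, p))
    (X : 'M[F]_(p, c)) (u : 'M[F]_(r, p)) :
  basis_matrix (colker M) X -> (u *m X == 0) = (u <= M)%MS.
Proof.
move=> basisX.
have MX0 : M *m X = 0.
  apply/matrixP => i j; rewrite mxE.
  have : col j X \in colker M.
    rewrite (basis_mem basisX) // (_ : col j X = [tuple col j X | j < c]`_j).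
      by rewrite mem_nth // size_tuple.
    by rewrite -tnth_nth tnth_mktuple.
  rewrite memv_ker lfunE /= => /eqP/colP/(_ i); rewrite !mxE => {2}<-.
  by apply: eq_bigr => l _; rewrite mxE.
apply/eqP/idP => [uX0 | /submxP[d ->]]; last by rewrite -mulmxA MX0 mulmx0.
rewrite submxE; apply/eqP/matrixP => i j.
have : col j (cokermx M) \in colker M.
  by rewrite memv_ker lfunE /= colE mulmxA mulmx_coker mul0mx.
move/(coord_basis basisX); set co := coord _ => Ecol.
have : u *m col j (cokermx M) = 0.
  rewrite Ecol mulmx_sumr big1 // => l _.
  by rewrite -tnth_nth tnth_mktuple -scalemxAr (colE l) mulmxA uX0 mul0mx scaler0.
by rewrite colE mulmxA -colE => /colP/(_ i); rewrite !mxE.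
Qed.

(** * Left null spaces over a field *)

Section LeftNull.

Variables (F : fieldType) (n m : nat) (A : 'M[F]_n.+1) (B : 'M[F]_(n.+1, m)).

(** The rows of [Z] lie in the left null space of [B, AB, ..., A^(h-1) B]; quantifying over
polynomials of degree [< h] lets one divide with remainder in inductions on [h]. *)
Definition kills_krylov (r : nat) (h : nat) (Z : 'M[F]_(r, n.+1)) : Prop :=
  forall q : {poly F}, (size q <= h)%N -> Z *m horner_mx A q *m B = 0.

Lemma horner_mxM_mulmx (p q : {poly F}) :
  horner_mx A (p * q) = horner_mx A p *m horner_mx A q.
Proof. by rewrite rmorphM. Qed.

Lemma horner_mx_XsubC (a : F) : horner_mx A ('X - a%:P) = A - a%:M.
Proof. by rewrite rmorphB /= horner_mx_X horner_mx_C. Qed.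

Lemma size_cofactor_XsubC (q : {poly F}) (a : F) (d : nat) :
  (size (q * ('X - a%:P))%R <= d.+1)%N -> (size q <= d)%N.
Proof.
have [-> _|q0] := eqVneq q 0; first by rewrite size_poly0.
by rewrite size_Mmonic ?monicXsubC // size_XsubC addn2.
Qed.

Lemma divX_XsubC (q : {poly F}) (a : F) (d : nat) : (size q <= d.+1)%N ->
  exists2 q1 : {poly F}, (size q1 <= d)%N & q = q1 * ('X - a%:P) + q.[a]%:P.
Proof.
move=> sq.
have /factor_theorem[q1 Eq1] : root (q - q.[a]%:P) a.
  by rewrite /root !hornerE subrr.
exists q1; last by rewrite -Eq1 subrK.
apply: (@size_cofactor_XsubC _ a); rewrite -Eq1.
by rewrite (leq_trans (size_polyD _ _)) // geq_max sq size_polyN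
           (leq_trans (size_polyC_leq1 _)).
Qed.

Lemma kills_krylovP (r h : nat) (Z : 'M[F]_(r, n.+1)) :
  kills_krylov h Z <-> Z *m \mxrow_(i < h) (A ^+ i *m B) = 0.
Proof.
rewrite mul_mxrow; split=> [killZ | Z0 q sq].
  apply/mxrow_eq0 => i.
  rewrite mulmxA -[X in X ^+ i]horner_mx_X -rmorphXn /=.
  by apply: killZ; rewrite size_polyXn.
have {Z0} ZAB := (mxrow_eq0 _).1 Z0.
have -> : q = \poly_(i < h) q`_i.
  apply/polyP => i; rewrite coef_poly; case: ltnP => // le_hi.
  by rewrite nth_default // (leq_trans sq).
rewrite poly_def rmorph_sum /= mulmx_sumr mulmx_suml big1 // => i _.
by rewrite linearZ /= rmorphXn /= horner_mx_X -scalemxAr -scalemxAl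
           -mulmxA ZAB scaler0.
Qed.

(** Induction on [s]. Let [p] be the product over the tail, [Z'] the solution
for the tail and [Za] the witness at [a]. As [p.[a] != 0], there is a Bezout
identity [c p + b (X - a) = 1] with a constant [c], and
[Z = c Za + Z' b(A)] solves the problem for [a :: s]: the identity gives
[Z (A - a) = Z'], which yields the equation for [Y], and it reduces the
annihilation up to degree [size s] to that of [Z'] and of [Z B = 0]. *)
Lemma left_null_glue (r : nat) (Y : 'M[F]_(r, n.+1)) (s : seq F) : uniq s ->
  {in s, forall a, exists2 Z : 'M[F]_(r, n.+1),
    Z *m (A - a%:M) = Y & Z *m B = 0} ->
  exists2 Z : 'M[F]_(r, n.+1),
    Z *m horner_mx A (\prod_(a <- s) ('X - a%:P)) = Y &
    kills_krylov (size s) Z.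
Proof.
elim: s => [_ _|a s IHs /= /andP[a_s uniq_s] HY].
  exists Y; first by rewrite big_nil rmorph1 mulmx1.
  by move=> q; rewrite leqn0 size_poly_eq0 => /eqP->; rewrite rmorph0 mulmx0 mul0mx.
have [|Z' Z'p killZ'] := IHs uniq_s.
  by move=> b b_s; apply: HY; rewrite inE b_s orbT.
have [Za ZaA ZaB] := HY a (mem_head a s).
rewrite big_cons; set p := \prod_(b <- s) _ in Z'p *.
have pa : p.[a] != 0 by rewrite -/(root p a) root_prod_XsubC.
(* [b] is minus the quotient of [c p] by [X - a], with [c = 1 / p.[a]], so its
   size is at most [size s], which is within the range killed by [Z']. *)
have [b sb Eb] : exists2 b : {poly F}, (size b <= size s)%N &
    p.[a]^-1 *: p + b * ('X - a%:P) = 1.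
  have [|q sq Eq] := @divX_XsubC (p.[a]^-1 *: p) a (size s).
    by rewrite (leq_trans (size_scale_leq _ _)) // size_prod_XsubC.
  exists (- q); first by rewrite size_polyN.
  by rewrite Eq hornerZ mulVf // mulNr addrAC subrr add0r.
pose Z := p.[a]^-1 *: Za + Z' *m horner_mx A b.
have ZA : Z *m horner_mx A ('X - a%:P) = Z'.
  rewrite mulmxDl -scalemxAl {1}horner_mx_XsubC ZaA -Z'p scalemxAr -linearZ /=.
  by rewrite -mulmxA -horner_mxM_mulmx -mulmxDr -rmorphD /= Eb rmorph1 mulmx1.
exists Z; first by rewrite horner_mxM_mulmx mulmxA ZA.
move=> q sq; have [q1 sq1 ->] := divX_XsubC a sq.
rewrite [q1 * _]mulrC rmorphD /= horner_mxM_mulmx horner_mx_C mulmxDr mulmxDl mulmxA ZA.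
rewrite killZ' // add0r mul_mx_scalar -scalemxAl mulmxDl -scalemxAl ZaB.
by rewrite killZ' // scaler0 add0r scaler0.
Qed.

(** One root [a] is cancelled at a time: with [p] the product over the other
roots, [Z p(A)] is killed by [A - a], and by [B] because [deg p] is still within
the range that [Z] annihilates. *)
Lemma left_null_inj (r : nat) (Z : 'M[F]_(r, n.+1)) (s : seq F) :
  {in s, forall a, row_free (row_mx (A - a%:M) B)} ->
  kills_krylov (size s) Z ->
  Z *m horner_mx A (\prod_(a <- s) ('X - a%:P)) = 0 -> Z = 0.
Proof.
elim: s => [_ _|a s IHs free_s killZ]; first by rewrite big_nil rmorph1 mulmx1.
rewrite big_cons mulrC horner_mxM_mulmx mulmxA horner_mx_XsubC => Zp0.
apply: IHs => [b b_s|q sq|].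
- by apply: free_s; rewrite inE b_s orbT.
- exact/killZ/leqW.
apply/eqP; rewrite -(mulmx_free_eq0 _ (free_s a (mem_head a s))) mul_mx_row Zp0.
by rewrite killZ ?row_mx0 // size_prod_XsubC.
Qed.

(** [V_null] is all that is used of the blocks [V i]: it describes their left
null spaces. Then [Z |-> Z *m P] carries the left null space of the Krylov
matrix bijectively onto that of [MV]. *)
Lemma rank_mxrow_krylov (h : nat) (lambda : 'I_h -> F) (k : 'I_h -> nat)
    (V : forall i, 'M[F]_(n.+1, k i)) : injective lambda ->
  (forall i, row_free (row_mx (A - (lambda i)%:M) B)) ->
  (forall i r (Y : 'M[F]_(r, n.+1)), Y *m V i = 0 <->
     exists2 Z : 'M[F]_(r, n.+1), Z *m (A - (lambda i)%:M) = Y & Z *m B = 0) ->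
  \rank (\mxrow_(i < h) V i) = \rank (\mxrow_(i < h) (A ^+ i *m B)).
Proof.
move=> lambda_inj free_pencil V_null.
set MV := mxrow _; set K := mxrow _.
pose s := [seq lambda i | i <- enum 'I_h].
have size_s : size s = h by rewrite size_map size_enum_ord.
pose P := horner_mx A (\prod_(a <- s) ('X - a%:P)).
have free_s : {in s, forall a, row_free (row_mx (A - a%:M) B)}.
  by move=> _ /mapP[i _ ->].
suff E : \rank (kermx MV) = \rank (kermx K).
  have := E; rewrite !mxrank_ker => /(congr1 (subn n.+1)).
  by rewrite !subKn ?rank_leq_row.
have <- : \rank (kermx K *m P) = \rank (kermx K).
  apply/mxrank_injP; set Z := (_ :&: _)%MS; apply/eqP.
  apply: (left_null_inj free_s); last exact/sub_kermxP/capmxSr.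
  by rewrite size_s; apply/kills_krylovP/sub_kermxP/capmxSl.
apply/eqP; rewrite eqn_leq; apply/andP; split; apply: mxrankS.
  have [||Z <- killZ] := @left_null_glue _ (kermx MV) s.
  - by rewrite map_inj_uniq // enum_uniq.
  - move=> _ /mapP[i _ ->]; apply/V_null.
    have := mulmx_ker MV; rewrite mul_mxrow => /mxrow_eq0; exact.
  apply: submxMr; apply/sub_kermxP/kills_krylovP; by rewrite -size_s.
apply/sub_kermxP; rewrite mul_mxrow; apply/mxrow_eq0 => i; apply/V_null.
have s_i : lambda i \in s by rewrite map_f // mem_enum.
pose p := \prod_(a <- rem (lambda i) s) ('X - a%:P).
have Ep : \prod_(a <- s) ('X - a%:P) = p * ('X - (lambda i)%:P).
  by rewrite (perm_big _ (perm_to_rem s_i)) big_cons mulrC.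
exists (kermx K *m horner_mx A p).
  by rewrite -mulmxA -horner_mx_XsubC -horner_mxM_mulmx -Ep.
have /kills_krylovP killK := mulmx_ker K.
apply: killK.
rewrite size_prod_XsubC size_rem // size_s prednK //.
exact: leq_ltn_trans (ltn_ord i).
Qed.

End LeftNull.

(** * Specialization to the complexified pair *)

Theorem theorem2 (R : realType) (n m h : nat)
    (A : 'M[R]_n) (B : 'M[R]_(n, m)) (lambda : 'I_h -> R[i])
    (k : 'I_h -> nat)
    (V : forall i : 'I_h, 'M[R[i]]_(n, k i))
    (W : forall i : 'I_h, 'M[R[i]]_(m, k i))
    (lambda_distinct : injective lambda)
    (lambda_controllable :
       forall i : 'I_h, ~~ uncontrollable_eigenvalue A B (lambda i))
    (VW_basis : forall i : 'I_h,
       basis_matrix (colker (pencil A B (lambda i))) (col_mx (V i) (W i))) :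
  \rank (\mxrow_(i < h) V i) =
  \rank (complexify (\mxrow_(i < h) (A ^+ i *m B))).
Proof.
case: n A B V lambda_controllable VW_basis => [|n'] A' B' V' ctrl basisVW.
  (* [horner_mx] only exists for matrices of positive size. *)
  by rewrite [mxrow _]flatmx0 [complexify _]flatmx0 !mxrank0.
have -> : complexify (\mxrow_(i < h) (A' ^+ i *m B')) =
    \mxrow_(i < h) (complexify A' ^+ i *m complexify B').
  rewrite /complexify map_mxrow; apply: eq_mxrow => i.
  by rewrite map_mxM rmorphXn.
apply: (rank_mxrow_krylov lambda_distinct) => [i|i r Y].
  by rewrite -row_leq_rank leqNgt ctrl.
split=> [YV0|[Z <- ZB0]].
  have : (row_mx Y 0 <= pencil A' B' (lambda i))%MS.
    rewrite -(mulmx_basis_colker_eq0 _ (basisVW i)) mul_row_col YV0.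
    by rewrite mul0mx addr0.
  by case/submxP=> Z; rewrite mul_mx_row => /eq_row_mx[EY EB]; exists Z.
have /eqP : row_mx (Z *m (complexify A' - (lambda i)%:M)) 0 *m
    col_mx (V' i) (W i) = 0.
  apply/eqP; rewrite (mulmx_basis_colker_eq0 _ (basisVW i)) -ZB0 -mul_mx_row.
  exact: submxMl.
by rewrite mul_row_col mul0mx addr0 => /eqP.
Qed.
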